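(* For all $m>n\ge1$, the cost-SR calculus has a proof of $\mathrm{cost}(\mathrm{BPHP}^m_n)=m-n$ of size polynomial in $m$ and $n$.
   Context: $\mathrm{BPHP}^m_n$ is the CNF with variables $p_{i,j}$ ($i\in[m]$, $j\in[n]$) and blocking variables $b_i$ ($i\in[m]$) and $b_{i,k,j}$ ($1\le i<k\le m$, $j\in[n]$), consisting of the clauses $\bigvee_{j\in[n]}p_{i,j}\lor b_i$ for $i\in[m]$ and $\lnot p_{i,j}\lor\lnot p_{k,j}\lor b_{i,k,j}$ for $1\le i<k\le m$, $j\in[n]$. Notation: a substitution maps variables to $0$, $1$ or literals (with $\sigma(\lnot x)=\lnot\sigma(x)$); $(\sigma\circ\tau)(x)=\sigma(\tau(x))$; total assignments assign Boolean values to all variables. $C{\upharpoonright}_\sigma$: apply $\sigma$ to the literals and simplify; $\Gamma{\upharpoonright}_\sigma$ is the multiset of $C{\upharpoonright}_\sigma\ne1$, $C\in\Gamma$. $\lnot C$ is the partial assignment falsifying all literals of $C$. $\Gamma\vdash_1 C$ means unit propagation on $\Gamma{\upharpoonright}_{\lnot C}$ derives the empty clause; $\Gamma\vdash_1\Delta$ means this for all $D\in\Delta$. $\mathrm{cost}(\alpha)$ is the number of blocking variables set to $1$ by a total assignment $\alpha$; $\mathrm{cost}(\Gamma)=\min\{\mathrm{cost}(\alpha):\alpha\models\Gamma\}$. $C$ is cost-SR w.r.t. $\Gamma$ if there is a substitution $\sigma$ with (1) $\Gamma{\upharpoonright}_{\lnot C}\vdash_1(\Gamma\cup\{C\}){\upharpoonright}_\sigma$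 and (2) $\mathrm{cost}(\tau\circ\sigma)\le\mathrm{cost}(\tau)$ for all total $\tau\supseteq\lnot C$. A cost-SR calculus derivation from $\Gamma$: sequence $D_1,\dots,D_t$, each in $\Gamma$, or by weakening/resolution from earlier clauses, or cost-SR w.r.t. $\Gamma\cup\{D_1,\dots,D_{i-1}\}$ with $\mathrm{Var}(D_i)\subseteq\mathrm{Var}(\Gamma)$; its size is $t$. A proof of $\mathrm{cost}(\Gamma)=k$ is a derivation containing $k$ unit clauses $b$ for $k$ distinct blocking variables and the unit clauses $\lnot b'$ for all other blocking variables $b'$. *)

(* Defs.v *)
From mathcomp Require Import all_boot.
Set Implicit Arguments. Unset Strict Implicit. Unset Printing Implicit Defensive.

Section Framework.
Variable V : finType.

(* literal (x, true) = x, (x, false) = ~x *)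
Definition lit := (V * bool)%type.
Definition clause := seq lit.
Definition cnf := seq clause.   (* a multiset of clauses *)

Definition neglit (l : lit) : lit := (l.1, ~~ l.2).

Inductive sval := SC of bool | SL of lit.

Definition subst := V -> sval.

Definition lit_sub (s : subst) (l : lit) : sval :=
  match s l.1 with
  | SC c => SC (if l.2 then c else ~~ c)
  | SL y => SL (if l.2 then y else neglit y)
  end.

Definition sv_true (v : sval) : bool := if v is SC true then true else false.
Definition sv_lit (v : sval) : option lit := if v is SL y then Some y else None.

(* C|_sigma : None stands for the constant 1 (satisfied clause) *)
Definition clause_restrict (s : subst) (C : clause) : option clause :=
  if has (fun l => sv_true (lit_sub s l)) C then None
  else Some (pmap (fun l => sv_lit (lit_sub s l)) C).

Definition cnf_restrict (s : subst) (F : cnf) : cnf :=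
  pmap (clause_restrict s) F.

(* ~C : the partial assignment falsifying all literals of C (first occurrence
   of a variable decides, relevant only for tautological C); identity on
   the remaining variables. *)
Definition negsub (C : clause) : subst := fun x =>
  let i := find (fun l : lit => l.1 == x) C in
  if i < size C then SC (~~ (nth (x, true) C i).2) else SL (x, true).

Inductive up_refutes : cnf -> Prop :=
| up_empty F : [::] \in F -> up_refutes F
| up_unit F (l : lit) : has (fun C => undup C == [:: l]) F ->
    up_refutes (cnf_restrict (negsub [:: neglit l]) F) -> up_refutes F.

Definition up_derives (F : cnf) (C : clause) : Prop :=
  up_refutes (cnf_restrict (negsub C) F).

Definition lit_val (t : V -> bool) (l : lit) : bool := t l.1 == l.2.

Definition comp_asg (t : V -> bool) (s : subst) : V -> bool := fun x =>
  match s x with SC c => c | SL y => lit_val t y end.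

Variable blk : pred V.

Definition cost (a : V -> bool) : nat := #|[set x | blk x && a x]|.

Definition vars_clause (C : clause) : seq V := map fst C.
Definition vars_cnf (F : cnf) : seq V := flatten (map vars_clause F).

Definition costSR (F : cnf) (C : clause) : Prop :=
  exists s : subst,
    (forall D, D \in cnf_restrict s (C :: F) ->
       up_derives (cnf_restrict (negsub C) F) D) /\
    (forall t : V -> bool, (forall l, l \in C -> lit_val t l = false) ->
       cost (comp_asg t s) <= cost t).

Definition weakening (prev : cnf) (D : clause) : Prop :=
  exists2 E, E \in prev & {subset E <= D}.

Definition resolution (prev : cnf) (D : clause) : Prop :=
  exists E1 E2 (x : V), [/\ E1 \in prev, E2 \in prev,
    (x, true) \in E1, (x, false) \in E2 &
    forall l, l \in D <->
      ((l \in E1 /\ l != (x, true)) \/ (l \in E2 /\ l != (x, false)))].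

Definition valid_step (G prev : cnf) (D : clause) : Prop :=
  D \in G \/ weakening prev D \/ resolution prev D \/
  (costSR (G ++ prev) D /\ {subset vars_clause D <= vars_cnf G}).

Definition derivation (G : cnf) (pi : seq clause) : Prop :=
  forall i, i < size pi -> valid_step G (take i pi) (nth [::] pi i).

Definition cost_proof (G : cnf) (k : nat) (pi : seq clause) : Prop :=
  derivation G pi /\
  exists S : {set V}, [/\ #|S| = k, {subset S <= blk},
     forall b, b \in S -> [:: (b, true)] \in pi &
     forall b, blk b -> b \notin S -> [:: (b, false)] \in pi].

End Framework.

Definition bphp_raw (m n : nat) : finType :=
  (('I_m * 'I_n) + ('I_m + ('I_m * 'I_m * 'I_n)))%type.

Definition bphp_valid (m n : nat) (x : bphp_raw m n) : bool :=
  match x with inr (inr (i, k, _)) => i < k | _ => true end.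

(* variables p_{i,j}, b_i, and b_{i,k,j} with i < k *)
Definition bvar (m n : nat) : finType := {x : bphp_raw m n | bphp_valid x}.

Definition bblk (m n : nat) : pred (bvar m n) :=
  fun x => if val x is inl _ then false else true.

Definition pvar (m n : nat) (i : 'I_m) (j : 'I_n) : bvar m n :=
  exist _ (inl (i, j)) isT.
Definition bvar1 (m n : nat) (i : 'I_m) : bvar m n :=
  exist _ (inr (inl i)) isT.

Definition BPHP (m n : nat) : cnf (bvar m n) :=
  [seq rcons [seq (pvar i j, true) | j <- enum 'I_n] (bvar1 n i, true)
   | i <- enum 'I_m]
  ++ pmap (fun t : 'I_m * 'I_m * 'I_n =>
       if @insub _ (@bphp_valid m n) (bvar m n) (inr (inr t)) is Some b then
         Some [:: (pvar t.1.1 t.2, false); (pvar t.1.2 t.2, false); (b, true)]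
       else None) [seq (ik, j) | ik <- [seq (i, k) | i <- enum 'I_m, k <- enum 'I_m], j <- enum 'I_n].

(* Main.v *)
Require Import Defs.
From mathcomp Require Import all_boot zify.
Set Implicit Arguments. Unset Strict Implicit. Unset Printing Implicit Defensive.

(* Apart from the hole clauses [~p_{i,j} \/ ~p_{l,j}], only unit clauses are
   derived. If [b_{i,l,j} = 1], giving up pigeon [i] (set [b_i = 1], all
   [p_{i,_} = 0]) and clearing the collision variables of [i] does not raise the
   cost, so [~b_{i,l,j}] is cost-SR; hole clauses follow by resolution. Then, for
   [s = 0, ..., n - 1]: if a pigeon [k > s] sits in hole [s], put pigeon [s] there
   instead and let [k] take over the holes and the blocking variable of [s]; this
   yields [~p_{k,s}] for all [k > s]. Hole [s] is then free for pigeon [s], which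
   yields [p_{s,s}], [~b_s] and [~p_{s,j}] for [j <> s]. Finally the pigeons
   [k >= n] have no hole left and [b_k] follows by unit propagation. *)

Lemma subset_catl (T : eqType) (s t : seq T) : {subset s <= s ++ t}.
Proof. by move=> x xs; rewrite mem_cat xs. Qed.

Lemma subset_catr (T : eqType) (s t : seq T) : {subset t <= s ++ t}.
Proof. by move=> x xt; rewrite mem_cat xt orbT. Qed.

(** * Restriction by negated clauses and unit propagation *)

Section UnitPropagation.
Variable V : finType.
Implicit Types (F G : cnf V) (C D E X : clause V) (c l u x y : lit V) (s : subst V).

(** On a tautological clause [negsub] cannot falsify every literal, so restrictions are computed
    only for clauses with this property. *)
Definition nontaut D := forall l, l \in D -> neglit l \notin D.

Lemma neglitK : involutive (@neglit V).
Proof. by case=> v b; rewrite /neglit /= negbK. Qed.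

Lemma neglit_neq l : neglit l != l.
Proof. by case: l => v b; rewrite /neglit xpair_eqE /= eqxx; case: b. Qed.

Lemma eq_var l x : x.1 = l.1 -> x = l \/ x = neglit l.
Proof. case: l x => [v []] [w []] /= ->; rewrite /neglit; auto. Qed.

Lemma nontaut_unit l : nontaut [:: l].
Proof. by move=> x; rewrite !inE => /eqP->; rewrite neglit_neq. Qed.

Lemma nontaut_mono (b : bool) D : (forall l, l \in D -> l.2 = b) -> nontaut D.
Proof.
move=> mono l lD; apply/negP => /mono; rewrite /= (mono _ lD).
by case: (b).
Qed.

Lemma negsubP D l : nontaut D -> l \in D -> negsub D l.1 = SC V (~~ l.2).
Proof.
move=> ntD lD; rewrite /negsub.
have hasD : has (fun l' : lit V => l'.1 == l.1) D by apply/hasP; exists l.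
rewrite -has_find hasD; congr (SC V (~~ _)).
have /eqP e1 := nth_find (l.1, true) hasD.
have := mem_nth (l.1, true) (etrans (esym (has_find _ _)) hasD).
by case: (eq_var e1) => -> // nlD; case/negP: (ntD _ lD).
Qed.

Lemma negsub_id D l : l \notin D -> neglit l \notin D ->
  negsub D l.1 = SL (l.1, true).
Proof.
move=> l1 l2; rewrite /negsub -has_find; case: hasP => // -[x xD /eqP e].
by case: (eq_var e) xD => ->; [rewrite (negPf l1) | rewrite (negPf l2)].
Qed.

Lemma restrict_negsub D X : nontaut D ->
  (forall x, x \in X -> neglit x \notin D) ->
  clause_restrict (negsub D) X = Some [seq x <- X | x \notin D].
Proof.
move=> ntD HX.
have sub x : x \in X ->
    lit_sub (negsub D) x = if x \in D then SC V false else SL x.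
  move=> xX; rewrite /lit_sub; case: ifPn => xD.
    by rewrite negsubP //; case: x.2.
  by rewrite negsub_id ?HX //; case: x {xX xD} => v [].
rewrite /clause_restrict; case: hasP => [[x xX]|_].
  by rewrite sub //; case: ifP.
congr Some; elim: X {HX} sub => //= x X IH sub.
rewrite sub ?mem_head // IH; last by move=> y yX; rewrite sub // inE yX orbT.
by case: ifP.
Qed.

Lemma mem_restrict D F X : nontaut D -> X \in F ->
  (forall x, x \in X -> neglit x \notin D) ->
  [seq x <- X | x \notin D] \in cnf_restrict (negsub D) F.
Proof.
move=> ntD XF HX; rewrite /cnf_restrict mem_pmap; apply/mapP; exists X => //.
by rewrite restrict_negsub.
Qed.

Lemma undup_nseq (T : eqType) k (x : T) : undup (nseq k.+1 x) = [:: x].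
Proof. by elim: k => //= k ->; rewrite mem_head. Qed.

(** Induction on the size of [E]: propagating the negation of its first literal removes that literal
    from [E] and keeps a suitable clause for each remaining one. The clauses [X] may be empty or
    repeat their literal. *)
Lemma up_refutes_units F E : E \in F ->
  (forall l, l \in E ->
     exists2 X, X \in F & forall x, x \in X -> x = neglit l) ->
  up_refutes F.
Proof.
have [N] := ubnP (size E); elim: N E F => // N IH [|l E] F /=.
  by move=> _ ? _; apply: up_empty.
rewrite ltnS => sE EF HE.
have [X XF HX] := HE l (mem_head _ _).
have [X0|Xn] := eqVneq X [::]; first by apply: up_empty; rewrite -X0.
have unX : undup X == [:: neglit l].
  have /all_pred1P -> : all (pred1 (neglit l)) X.
    by apply/allP => x /HX ->; apply: eqxx.
  by case: X Xn {XF HX} => // a X _; rewrite undup_nseq.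
apply: (up_unit (l := neglit l)); first by apply/hasP; exists X.
rewrite neglitK.
(* If [E] also contains [neglit l], the propagation satisfies [E]; but the clause given for
   [neglit l] holds only copies of [l] and becomes empty. *)
have [lE|lE] := boolP (neglit l \in E).
  have [Y YF HY] := HE (neglit l) ltac:(by rewrite inE lE orbT).
  apply: up_empty.
  have := @mem_restrict [:: l] F Y (@nontaut_unit l) YF.
  rewrite (_ : [seq x <- Y | _] = [::]).
    by apply=> x /HY ->; rewrite !neglitK inE neglit_neq.
  apply/eqP; rewrite -[_ == _]negbK -has_filter; apply/hasPn => x /HY ->.
  by rewrite neglitK inE eqxx.
have HlE x : x \in l :: E -> neglit x \notin [:: l].
  rewrite !inE => /orP[/eqP->|xE]; first exact: neglit_neq.
  by apply: contra lE => /eqP <-; rewrite neglitK.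
apply: (IH [seq x <- l :: E | x \notin [:: l]]).
- rewrite /= mem_head /=; apply: leq_ltn_trans sE.
  by rewrite size_filter count_size.
- by apply: mem_restrict => //; apply: nontaut_unit.
move=> y; rewrite mem_filter => /andP[yl yE]; have [Y YF HY] := HE y yE.
exists [seq x <- Y | x \notin [:: l]].
  apply: mem_restrict => //; first exact: nontaut_unit.
  by move=> x /HY ->; rewrite neglitK.
by move=> x; rewrite mem_filter => /andP[_ /HY].
Qed.

(** For [l] other than [c], falsifying [c] leaves of such a clause at most copies of [neglit l], so
    propagation falsifies [l] or meets the empty clause. *)
Definition killed F c l :=
  exists2 X, X \in F & forall x, x \in X -> x = neglit l \/ x = c.

(** Once [c] and [D] are falsified, the literals left in [E] are contradicted by unit clauses, so
    [up_refutes_units] applies. The first two hypotheses make the two falsifications consistent. *)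
Lemma up_derives_unit F c D E : nontaut D -> neglit c \notin D -> E \in F ->
  (forall l, l \in E -> [\/ l = c, l \in D | killed F c l]) ->
  up_derives (cnf_restrict (negsub [:: c]) F) D.
Proof.
move=> ntD cD EF HE; rewrite /up_derives.
pose dead x := (x == c) || (x \in D).
have live X : X \in F -> (forall x, x \in X -> ~~ dead x -> ~~ dead (neglit x)) ->
    [seq x <- X | ~~ dead x] \in
      cnf_restrict (negsub D) (cnf_restrict (negsub [:: c]) F).
  move=> XF HX.
  have -> : [seq x <- X | ~~ dead x] =
      [seq x <- [seq x <- X | x \notin [:: c]] | x \notin D].
    rewrite -filter_predI; apply: eq_filter => x /=.
    by rewrite /dead negb_or inE andbC.
  have ndead x : x \in X -> ~~ dead (neglit x).
    move=> xX; have [dx|/(HX _ xX)//] := boolP (dead x).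
    rewrite negb_or; case/orP: dx => [/eqP->|xD]; first by rewrite neglit_neq.
    rewrite ntD // andbT; apply: contra cD => /eqP <-; by rewrite neglitK.
  apply: mem_restrict => //; last first.
    by move=> x; rewrite mem_filter => /andP[_ /ndead]; rewrite negb_or => /andP[].
  apply: mem_restrict => //; first exact: nontaut_unit.
  by move=> x /ndead; rewrite negb_or inE => /andP[].
(* A clause of dead literals gives the empty clause at once. Otherwise a live literal of [E] cannot
   have a dead negation, as its killing clause would be all dead; so [E] and the killing clauses
   survive both restrictions. *)
have [/hasP[X XF /allP HX]|/hasPn noX] := boolP (has (all dead) F).
  have dX : [seq x <- X | ~~ dead x] = [::].
    apply/eqP; rewrite -[_ == _]negbK -has_filter; apply/hasPn => x /HX.
    by rewrite negbK.
  by apply: up_empty; rewrite -[X in X \in _]dX; apply: live => // x /HX ->.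
have kill l : l \in E -> ~~ dead l -> killed F c l /\ ~~ dead (neglit l).
  move=> lE; rewrite negb_or => /andP[lc lD].
  case: (HE l lE) => [e|e|[X XF HX]]; [by rewrite e eqxx in lc|by rewrite e in lD|].
  split; first by exists X.
  apply: contra (noX X XF) => dl; apply/allP => x /HX[->//|->].
  by rewrite /dead eqxx.
apply: (up_refutes_units (E := [seq x <- E | ~~ dead x])).
  by apply: live => // x xE /(kill x xE)[].
move=> l; rewrite mem_filter => /andP[dl lE].
have [[X XF HX] dnl] := kill l lE dl.
exists [seq x <- X | ~~ dead x].
  apply: live => // x /HX[->|->]; first by rewrite neglitK.
  by rewrite /dead eqxx.
move=> x; rewrite mem_filter => /andP[dx /HX[//|e]].
by rewrite e /dead eqxx in dx.
Qed.

(** * General substitutions and the cost-SR rule for unit clauses *)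

Lemma restrict_sat s X D x : clause_restrict s X = Some D -> x \in X ->
  lit_sub s x = SC V true -> False.
Proof.
rewrite /clause_restrict; case: hasP => // nh _ xX e.
by apply: nh; exists x; rewrite ?e.
Qed.

Lemma mem_restrictE s X D y : clause_restrict s X = Some D ->
  (y \in D) <-> exists2 x, x \in X & lit_sub s x = SL y.
Proof.
rewrite /clause_restrict; case: hasP => // _ [<-]; rewrite mem_pmap; split.
  by case/mapP=> x xX; case e: (lit_sub s x) => // -[->]; exists x.
by case=> x xX e; apply/mapP; exists x; rewrite ?e.
Qed.

Lemma restrict_id s X D :
  (forall x, x \in X -> s x.1 = SL (x.1, true)) ->
  clause_restrict s X = Some D -> X =i D.
Proof.
move=> HX e y.
have sub x : x \in X -> lit_sub s x = SL x.
  by move=> /HX; rewrite /lit_sub => ->; case: x => v [].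
apply/idP/idP => [yX|]; first by apply/(mem_restrictE _ e); exists y; rewrite ?sub.
by case/(mem_restrictE _ e) => x xX; rewrite sub // => -[<-].
Qed.

(** A clause left unchanged by the substitution derives itself: take [X] for [E]. *)
Lemma derivable_trivial F c X D : X =i D -> nontaut X -> X \in F ->
  nontaut D /\ exists2 E, E \in F &
       forall l, l \in E -> [\/ l = c, l \in D | killed F c l].
Proof.
move=> eq ntX XF; split; last first.
  by exists X => // l; rewrite eq; constructor 2.
by move=> l; rewrite -eq => /ntX; rewrite eq.
Qed.

Variable blk : pred V.

(** Replaces unit propagation by one check per restricted clause. The first hypothesis keeps the
    variable of [c] out of the image of [s], so no restricted clause contains [neglit c]. *)
Lemma costSR_unit F c s :
  (forall v y, s v = SL y -> y.1 <> c.1) ->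
  (forall X D, X \in [:: c] :: F -> clause_restrict s X = Some D ->
     nontaut D /\ exists2 E, E \in F &
       forall l, l \in E -> [\/ l = c, l \in D | killed F c l]) ->
  (forall t, lit_val t c = false -> cost blk (comp_asg t s) <= cost blk t) ->
  costSR blk F [:: c].
Proof.
move=> im res cst; exists s; split; last by move=> t Ht; apply/cst/Ht/mem_head.
move=> D; rewrite /cnf_restrict mem_pmap => /mapP[X XF /esym e].
have [ntD [E EF HE]] := res X D XF e.
apply: (up_derives_unit ntD _ EF HE).
apply/negP => /(mem_restrictE _ e)[[v b] _]; rewrite /lit_sub /=.
case ev: (s v) => [|y] // [ey]; apply: (im v y ev).
by case: b ey => [->|/(congr1 fst)].
Qed.

(* Moving weight injectively: [t'] may set [v] only at the expense of [w]. *)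
Lemma cost_move (t t' : V -> bool) (v w : V) : blk w ->
  (forall x : V, blk x -> x != v -> t' x -> (x != w) && t x) ->
  (t' v -> t w) -> cost blk t' <= cost blk t.
Proof.
(* [f] redirects [v] to [w]; it stays injective because [t'] leaves [w] unset when [w] differs from
   [v]. *)
move=> bw Hx Hv; pose f (x : V) := if x == v then w else x.
rewrite /cost -(card_in_imset (f := f)).
  apply/subset_leq_card/subsetP => _ /imsetP[x + ->].
  rewrite !inE /f => /andP[bx tx].
  case: eqVneq tx => [->/Hv->|ne tx]; first by rewrite bw.
  by rewrite bx; case/andP: (Hx x bx ne tx).
move=> x y; rewrite !inE /f => /andP[bx tx] /andP[by_ ty].
case: (eqVneq x v) (eqVneq y v) => [->|nx] [->|ny] // e.
  by have := Hx y by_ ny ty; rewrite e eqxx.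
by have := Hx x bx nx tx; rewrite -e eqxx.
Qed.

(** Each clause of [L] is checked against an arbitrary part [L'] of [L] instead of the actual
    prefix, so the order inside [L] need not be tracked. *)
Lemma derivation_cat F (pi L : cnf V) : derivation blk F pi ->
  (forall L', {subset L' <= L} -> forall D, D \in L ->
     valid_step blk F (pi ++ L') D) ->
  derivation blk F (pi ++ L).
Proof.
move=> dpi HL i; rewrite size_cat => ilt; rewrite take_cat nth_cat.
case: ltnP => [/dpi//|ge].
apply: HL => [x /mem_take//|]; apply: mem_nth.
by rewrite ltn_subLR.
Qed.

End UnitPropagation.

(** * Variables and clauses of [BPHP], and the clauses derived first *)

Section Pigeonhole.
Variables m n : nat.
Local Notation var := (bvar m n).
Implicit Types (i k l : 'I_m) (j : 'I_n) (x : var) (u c : lit var)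
  (X D : clause var) (F : cnf var).

Definition pigeon_clause i : clause var :=
  rcons [seq (pvar i j, true) | j <- enum 'I_n] (bvar1 n i, true).

Definition hole_clause i l j : clause var :=
  [:: (pvar i j, false); (pvar l j, false)].

Definition collision x : bool := if val x is inr (inr _) then true else false.

(** The collision case keeps an equation on [val x], since such a variable carries its own proof of
    [i < l]. *)
Variant bvar_spec : var -> Type :=
| BvarP i j : bvar_spec (pvar i j)
| BvarB i : bvar_spec (bvar1 n i)
| BvarC x i l j of val x = inr (inr (i, l, j)) & i < l : bvar_spec x.

Lemma bvarP x : bvar_spec x.
Proof.
case e: (val x) => [[i j]|[i|[[i l] j]]].
- have -> : x = pvar i j by apply: val_inj; rewrite e.
  by constructor.
- have -> : x = bvar1 n i by apply: val_inj; rewrite e.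
  by constructor.
- by apply: (BvarC e); have := valP x; rewrite e.
Qed.

Lemma mem_pigeon_clause i u :
  u \in pigeon_clause i ->
  (exists j, u = (pvar i j, true)) \/ u = (bvar1 n i, true).
Proof.
rewrite mem_rcons inE => /orP[/eqP|/mapP[j _]]; first by right.
by left; exists j.
Qed.

Lemma pvar_pigeon_clause i j : (pvar i j, true) \in pigeon_clause i.
Proof. by rewrite mem_rcons inE; apply/orP; right; rewrite map_f ?mem_enum. Qed.

Lemma bvar1_pigeon_clause i : (bvar1 n i, true) \in pigeon_clause i.
Proof. by rewrite mem_rcons mem_head. Qed.

Lemma pigeon_clause_BPHP i : pigeon_clause i \in BPHP m n.
Proof.
by rewrite mem_cat; apply/orP; left; apply: map_f; rewrite mem_enum.
Qed.

Lemma collision_clause_BPHP x i l j : val x = inr (inr (i, l, j)) ->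
  rcons (hole_clause i l j) (x, true) \in BPHP m n.
Proof.
move=> e; rewrite mem_cat mem_pmap; apply/orP; right; apply/mapP.
exists (i, l, j); last by rewrite -e valK.
apply: (allpairs_f pair); last by rewrite mem_enum.
by apply: (allpairs_f pair); rewrite mem_enum.
Qed.

Lemma BPHP_inv X : X \in BPHP m n ->
  (exists i, X = pigeon_clause i) \/
  (exists x i l j, [/\ val x = inr (inr (i, l, j)), i < l &
     X = rcons (hole_clause i l j) (x, true)]).
Proof.
rewrite mem_cat => /orP[/mapP[i _ ->]|]; first by left; exists i.
rewrite mem_pmap => /mapP[[[i l] j] _]; case: insubP => // x lt_il e [->].
by right; exists x, i, l, j.
Qed.

Definition no_collision : cnf var :=
  [seq [:: (x, false)] | x <- enum {: var} & collision x].

(** Both orders of each pair of pigeons occur, because renaming a pigeon may reverse the order of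
    the pair. *)
Definition hole_clauses : cnf var :=
  [seq hole_clause t.1.1 t.1.2 t.2
    | t <- enum {: 'I_m * 'I_m * 'I_n} & t.1.1 != t.1.2].

Definition basis : cnf var := BPHP m n ++ (no_collision ++ hole_clauses).

Lemma no_collision_mem x : collision x -> [:: (x, false)] \in no_collision.
Proof.
by move=> cx; apply: (map_f (fun x => [:: (x, false)])); rewrite mem_filter cx mem_enum.
Qed.

Lemma hole_clauses_mem i l j : i != l -> hole_clause i l j \in hole_clauses.
Proof.
move=> ne; apply: (map_f _ (x := (i, l, j))).
by rewrite mem_filter ne mem_enum.
Qed.

Lemma vars_BPHP x : 0 < n -> x \in vars_cnf (BPHP m n).
Proof.
move=> n0.
suff [X XF xX] : exists2 X, X \in BPHP m n & (x, true) \in X.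
  apply/flattenP; exists (vars_clause X); first exact: map_f.
  exact: (map_f fst xX).
case: (bvarP x) => [i j|i|{}x i l j e _].
- exists (pigeon_clause i); [exact: pigeon_clause_BPHP|exact: pvar_pigeon_clause].
- exists (pigeon_clause i); [exact: pigeon_clause_BPHP|exact: bvar1_pigeon_clause].
- exists (rcons (hole_clause i l j) (x, true)); last by rewrite mem_rcons mem_head.
  exact: collision_clause_BPHP.
Qed.

(** * Ejecting a pigeon to refute a collision variable *)

Definition eject_sub i : subst var := fun x =>
  match val x with
  | inl (i', j) => if i' == i then SC var false else SL (x, true)
  | inr (inl i') => if i' == i then SC var true else SL (x, true)
  | inr (inr (a, b, j)) =>
      if (a == i) || (b == i) then SC var false else SL (x, true)
  end.

(** Ejecting [i] satisfies every clause that mentions pigeon [i] and leaves all other clauses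
    unchanged, so nothing has to be propagated. *)
Lemma eject_step F x : collision x ->
  {subset BPHP m n <= F} -> {subset F <= BPHP m n ++ no_collision} ->
  costSR (@bblk m n) F [:: (x, false)].
Proof.
move=> cx lo up.
case: (bvarP x) cx => // {}x i l j ex lt_il _.
have sx : eject_sub i x = SC var false by rewrite /eject_sub ex eqxx.
apply: (costSR_unit (s := eject_sub i)).
- move=> v y; rewrite /eject_sub; case: (bvarP v) => [a b|a|{}v a b d e _] /=;
    rewrite ?e; case: ifP => // ne [<-] /=.
  + by move=> /(congr1 val); rewrite /= ex.
  + by move=> /(congr1 val); rewrite /= ex.
  + by move=> ev; move: e ne; rewrite ev ex => -[<- _ _]; rewrite eqxx.
- move=> X D; rewrite inE => /orP[/eqP->|XF] e.
    by case: (restrict_sat e (mem_head _ _)); rewrite /lit_sub sx.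
  have XG : X \in BPHP m n ++ no_collision by apply: up.
  move: XG; rewrite mem_cat => /orP[/BPHP_inv[[a eX]|[v [a [b [d [ev lt_ab eX]]]]]]|].
  + have [ea|ne] := eqVneq a i.
      case: (restrict_sat e (x := (bvar1 n a, true))).
        by rewrite eX bvar1_pigeon_clause.
      by rewrite /lit_sub /eject_sub /= ea eqxx.
    apply: derivable_trivial XF.
      apply: restrict_id e => y; rewrite eX /eject_sub.
      by move=> /mem_pigeon_clause[[d ->]|->] /=; rewrite (negPf ne).
    rewrite eX; apply: (nontaut_mono (b := true)) => y.
    by move=> /mem_pigeon_clause[[d ->]|->].
  + have [ea|nea] := eqVneq a i.
      case: (restrict_sat e (x := (pvar a d, false))).
        by rewrite eX mem_head.
      by rewrite /lit_sub /eject_sub /= ea eqxx.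
    have [eb|neb] := eqVneq b i.
      case: (restrict_sat e (x := (pvar b d, false))).
        by rewrite eX !inE eqxx orbT.
      by rewrite /lit_sub /eject_sub /= eb eqxx.
    apply: derivable_trivial XF.
      apply: restrict_id e => y; rewrite eX /eject_sub !inE.
      by case/or3P=> /eqP-> /=; rewrite ?ev ?(negPf nea) ?(negPf neb).
    rewrite eX => y; rewrite !inE /neglit !xpair_eqE.
    case/or3P=> /eqP-> /=; rewrite ?eqxx ?andbF ?orbF ?andbT //=.
    * by apply/eqP => /(congr1 val); rewrite /= ev.
    * by apply/eqP => /(congr1 val); rewrite /= ev.
    * by rewrite negb_or; apply/andP; split; apply/eqP => /(congr1 val); rewrite /= ev.
  + case/mapP=> v; rewrite mem_filter => /andP[cv _] eX.
    case: (bvarP v) cv eX => // {}v a b d ev _ _ eX.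
    have [eab|/norP[nea neb]] := boolP ((a == i) || (b == i)).
      case: (restrict_sat e (x := (v, false))); first by rewrite eX mem_head.
      by rewrite /lit_sub /eject_sub /= ev eab.
    apply: derivable_trivial XF; last by rewrite eX; apply: nontaut_unit.
    apply: restrict_id e => y; rewrite eX inE => /eqP-> /=.
    by rewrite /eject_sub ev (negPf nea) (negPf neb).
- move=> t /= tx.
  (* The new cost of [b_i] is paid by [x], which [t] sets to 1 and the ejection clears. *)
  apply: (cost_move (v := bvar1 n i) (w := x)) => [|v bv nv|_].
  + by rewrite /bblk ex.
  + rewrite /comp_asg; have [->|_] := eqVneq v x; first by rewrite sx.
    rewrite /eject_sub; case: (bvarP v) bv nv => [//|a|{}v a b d ev _] _ nv /=.
      case: ifP => [/eqP ea|_ ]; first by rewrite ea eqxx in nv.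
      by rewrite /lit_val /= eqb_id.
    by rewrite ev; case: ifP => //; rewrite /lit_val /= eqb_id.
  + by move: tx; rewrite /lit_val /=; case: (t x).
Qed.

(** * Placing pigeon [s] in hole [s] *)

(* The unit literals available once the pigeons [i < s] sit in their holes [i]. *)
Definition placed (s : nat) : pred (lit var) := fun u =>
  match val u.1 with
  | inl (i, j) =>
      if u.2 then (i == j :> nat) && (i < s)
      else (i != j :> nat) && ((i < s) || (j < s))
  | inr (inl i) => ~~ u.2 && (i < s)
  | inr (inr _) => false
  end.

Definition basis_or_unit (up : pred (lit var)) F :=
  forall X, X \in F -> X \in basis \/ exists2 u, up u & X = [:: u].

Definition swap_pigeon (s k i : 'I_m) : 'I_m := if i == k then s else i.

(* Pigeon [s] enters hole [s] and pigeon [k] inherits the former holes of [s];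
   for [k = s] nobody inherits them. *)
Definition swap_sub (s k : 'I_m) : subst var := fun x =>
  match val x with
  | inl (i, j) =>
      if j == s :> nat then SC var (i == s)
      else if i == s then SC var false else SL (pvar (swap_pigeon s k i) j, true)
  | inr (inl i) =>
      if i == s then SC var false else SL (bvar1 n (swap_pigeon s k i), true)
  | inr (inr _) => SC var false
  end.

(** A substitution with only positive literal values preserves signs. Variables sent to 0 are exempt
    from the sign condition, which admits hole clauses that still carry a collision literal. *)
Lemma sub_mono (b : bool) (s : subst var) X D :
  (forall x y, s x = SL y -> y.2 = true) ->
  clause_restrict s X = Some D ->
  (forall u, u \in X -> s u.1 <> SC var false -> u.2 = b) -> nontaut D.
Proof.
move=> pos e mono; apply: (nontaut_mono (b := b)) => y.
case/(mem_restrictE _ e) => u uX su; rewrite -(mono u uX); last first.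
  by move: su; rewrite /lit_sub => + eu; rewrite eu.
move: su; rewrite /lit_sub; case eu: (s u.1) => [|z] // [<-].
by case: ifP => _ /=; rewrite (pos _ _ eu).
Qed.

Lemma mem_restrict_pos (s : subst var) X D x y :
  clause_restrict s X = Some D -> (x, true) \in X -> s x = SL (y, true) ->
  (y, true) \in D.
Proof.
move=> e xX sx; apply/(mem_restrictE _ e); exists (x, true) => //.
by rewrite /lit_sub sx.
Qed.

Lemma mem_restrict_neg (s : subst var) X D x y :
  clause_restrict s X = Some D -> (x, false) \in X -> s x = SL (y, true) ->
  (y, false) \in D.
Proof.
move=> e xX sx; apply/(mem_restrictE _ e); exists (x, false) => //.
by rewrite /lit_sub sx.
Qed.

(** The third case merges hole clauses with and without their collision literal, as later
    substitutions send collision variables to 0. *)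
Lemma basis_inv X : X \in basis ->
  [\/ exists i, X = pigeon_clause i,
      exists2 x, collision x & X = [:: (x, false)] |
      exists i l j, [/\ i != l, {subset hole_clause i l j <= X} &
        forall u, u \in X -> u \in hole_clause i l j \/ collision u.1]].
Proof.
rewrite mem_cat => /orP[/BPHP_inv[[i ->]|]|]; last rewrite mem_cat => /orP[].
- by constructor 1; exists i.
- case=> x [i [l [j [ex lt_il ->]]]]; constructor 3; exists i, l, j; split.
  + by rewrite neq_ltn lt_il.
  + by move=> u ul; rewrite mem_rcons inE ul orbT.
  + move=> u; rewrite mem_rcons inE => /orP[/eqP->|]; last by left.
    by right; rewrite /collision ex.
- case/mapP=> x; rewrite mem_filter => /andP[cx _] ->.
  by constructor 2; exists x.
- case/mapP=> -[[i l] j]; rewrite mem_filter => /andP[ne _] ->.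
  by constructor 3; exists i, l, j; split=> //= u; left.
Qed.

(** The swap satisfies every clause naming pigeon [s]. A clause naming other pigeons is satisfied or
    goes to the clause for the renamed pigeons, which [F] contains up to a killed literal on hole
    [s]. This covers both [k > s] and [k = s]. *)
Lemma swap_step (s k : 'I_m) F c : s <= k -> s < n ->
  {subset basis <= F} -> basis_or_unit (placed s.+1) F ->
  (forall u, placed s u -> [:: u] \in F) ->
  lit_sub (swap_sub s k) c = SC var true ->
  (forall x y, swap_sub s k x = SL y -> y.1 <> c.1) ->
  (forall i j, i != k -> j == s :> nat -> killed F c (pvar i j, true)) ->
  costSR (@bblk m n) F [:: c].
Proof.
move=> le_sk lt_sn lo up units sat im kill.
have pos x y : swap_sub s k x = SL y -> y.2 = true.
  by rewrite /swap_sub; case: (val x) => [[i j]|[i|_]] //; do ?case: ifP => // _;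
     case=> <-.
have subC x : collision x -> swap_sub s k x = SC var false.
  by rewrite /collision /swap_sub; case: (val x) => [[]|[]].
have swap_neq i : i != s -> swap_pigeon s k i != k.
  move=> ne; rewrite /swap_pigeon; case: ifP => [/eqP ik|/negbT//].
  by rewrite -ik eq_sym.
apply: (costSR_unit (s := swap_sub s k)) => //.
- move=> X D; rewrite inE => /orP[/eqP->|XF] e.
    by case: (restrict_sat e (mem_head _ _)).
  have keep : (forall u, u \in X -> swap_sub s k u.1 = SL (u.1, true)) ->
      nontaut X -> nontaut D /\ exists2 E, E \in F &
        forall u, u \in E -> [\/ u = c, u \in D | killed F c u].
    by move=> Hid ntX; apply: derivable_trivial XF => //; apply: restrict_id e.
  case: (up X XF) => [/basis_inv[[i eX]|[x cx eX]|[i [l [j [ne sub inX]]]]]|[u pu eX]].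
  + have [ei|nei] := eqVneq i s.
      case: (restrict_sat e (x := (pvar i (Ordinal lt_sn), true))).
        by rewrite eX pvar_pigeon_clause.
      by rewrite /lit_sub /swap_sub /= eqxx ei eqxx.
    split.
      apply: (sub_mono (b := true) pos e) => u.
      by rewrite eX => /mem_pigeon_clause[[j ->]|->].
    (* The image lacks the literal on hole [s]; in the clause chosen here that literal is killed,
       since the renamed pigeon is never [k]. *)
    exists (pigeon_clause (swap_pigeon s k i)).
      exact/lo/subset_catl/pigeon_clause_BPHP.
    move=> u /mem_pigeon_clause[[j ->]|->].
      have [ej|nej] := eqVneq (j : nat) s.
        by constructor 3; apply: kill; rewrite ?swap_neq ?ej.
      constructor 2; apply: (mem_restrict_pos (x := pvar i j) e).
        by rewrite eX pvar_pigeon_clause.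
      by rewrite /swap_sub /= (negPf nei) (negPf nej).
    constructor 2; apply: (mem_restrict_pos (x := bvar1 n i) e).
      by rewrite eX bvar1_pigeon_clause.
    by rewrite /swap_sub /= (negPf nei).
  + case: (restrict_sat e (x := (x, false))); first by rewrite eX mem_head.
    by rewrite /lit_sub subC.
  + have iX : (pvar i j, false) \in X by apply: sub; rewrite mem_head.
    have lX : (pvar l j, false) \in X by apply: sub; rewrite !inE eqxx orbT.
    have satX a : (pvar a j, false) \in X ->
        swap_sub s k (pvar a j) <> SC var false.
      move=> aX ea; apply: (restrict_sat e aX); by rewrite /lit_sub ea.
    (* A hole clause naming [s] is satisfied: off hole [s] because [p_{s,j}] becomes 0, on hole [s]
       because the other pigeon is removed from it. *)
    have [ei|nei] := eqVneq i s.
      have := satX _ iX; have := satX _ lX.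
      rewrite /swap_sub /= ei eqxx; case: ifP => // _.
      by case: eqP => // els; rewrite ei els eqxx in ne.
    have [el|nel] := eqVneq l s.
      have := satX _ iX; rewrite /swap_sub /= (negPf nei); case: ifP => // nj _.
      by have := satX _ lX; rewrite /swap_sub /= el eqxx nj.
    have nej : j != s :> nat.
      apply/negP => ej; have := satX _ iX.
      by rewrite /swap_sub /= ej (negPf nei).
    split.
      apply: (sub_mono (b := false) pos e) => u /inX[|cu []]; last exact: subC.
      by rewrite !inE => /orP[]/eqP->.
    exists (hole_clause (swap_pigeon s k i) (swap_pigeon s k l) j).
      apply/lo/subset_catr/subset_catr/hole_clauses_mem.
      rewrite /swap_pigeon; case: (eqVneq i k) => [ei|_]; case: (eqVneq l k) => [el|_] //.
        by rewrite ei el eqxx in ne.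
      by rewrite eq_sym.
    move=> u; rewrite !inE => /orP[]/eqP->; constructor 2.
      apply: (mem_restrict_neg e iX).
      by rewrite /swap_sub /= (negPf nei) (negPf nej).
    apply: (mem_restrict_neg e lX).
    by rewrite /swap_sub /= (negPf nel) (negPf nej).
  + have unsat : lit_sub (swap_sub s k) u <> SC var true.
      by apply: (restrict_sat e); rewrite eX mem_head.
    case: u pu eX unsat => v b; rewrite /placed /lit_sub /swap_sub /=.
    case: (bvarP v) => [i j|i|{}v i l j -> _] //=.
      move=> pij eX; case: ifP => [ej|nej].
        have -> : (i == s) = b by rewrite -val_eqE /=; case: b pij {eX}; lia.
        by case: (b) => /(_ erefl).
      case: ifP => [/eqP ei|nei]; first by case: b pij eX => //=; rewrite ei; lia.
      case: b pij eX => /= pij eX _.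
        apply: keep; last by rewrite eX; apply: nontaut_unit.
        move=> u; rewrite eX inE => /eqP-> /=.
        rewrite /swap_sub /= nej nei /swap_pigeon; case: ifP => // /eqP ik.
        by move: pij nei; rewrite ik -val_eqE /=; lia.
      rewrite eX in e keep.
      have [ik|nik] := eqVneq i k; last first.
        apply: keep; last by apply: nontaut_unit.
        move=> u; rewrite inE => /eqP-> /=.
        by rewrite /swap_sub /= nej nei /swap_pigeon (negPf nik).
      (* Here [k > s] and [j] is not [s], so [placed s.+1] forces [j < s], and the image [~p_{s,j}]
         is a unit of [placed s]. *)
      have eD : D = [:: (pvar s j, false)].
        move: e; rewrite /clause_restrict /= /lit_sub /swap_sub /= nej nei.
        by rewrite /swap_pigeon ik eqxx => -[<-].
      split; first by rewrite eD; apply: nontaut_unit.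
      exists D; last by move=> u uD; constructor 2.
      rewrite eD; apply: units; rewrite /placed /=.
      by move: pij nei nej; rewrite ik -val_eqE /=; lia.
    move=> /andP[/negbTE-> /= lt_is] eX; case: ifP => // nei _.
    apply: keep; last by rewrite eX; apply: nontaut_unit.
    move=> u; rewrite eX inE => /eqP-> /=.
    rewrite /swap_sub /= nei /swap_pigeon; case: ifP => // /eqP ik.
    by move: lt_is nei; rewrite ik -val_eqE /=; lia.
- move=> t _.
  (* [b_k] takes over the value of [b_s], while [b_s] itself becomes 0. *)
  apply: (cost_move (v := bvar1 n k) (w := bvar1 n s)) => [//|v bv nv|].
  + rewrite /comp_asg /swap_sub; case: (bvarP v) bv nv => [//|i|{}v i l j ev _] _ nv /=;
      last by rewrite ev.
    case: ifP => // nei; rewrite /swap_pigeon; case: ifP => [/eqP ik|nik].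
      by rewrite ik eqxx in nv.
    rewrite /lit_val /= eqb_id => ->; rewrite andbT.
    by apply/eqP => -[ei]; rewrite ei eqxx in nei.
  + rewrite /comp_asg /swap_sub /=; case: ifP => // _.
    by rewrite /swap_pigeon eqxx /lit_val /= eqb_id.
Qed.

(** * Blocking the pigeons without a hole *)

Definition unplaced : pred (lit var) := fun u =>
  if val u.1 is inr (inl i) then u.2 && (n <= i) else false.

(** Only clearing variables, it cannot raise the cost; clearing [b_k] keeps the variable of the
    target clause out of the image. *)
Definition drop_sub k : subst var := fun x =>
  match val x with
  | inl (i, _) => if i == k then SC var false else SL (x, true)
  | inr (inl i) => if i == k then SC var false else SL (x, true)
  | inr (inr _) => SC var false
  end.

(** With [b_k] falsified, the units [~p_{k,j}] refute the clause of pigeon [k], so any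
    non-tautological [D] is derived. *)
Lemma unplaced_step k F : n <= k ->
  {subset basis <= F} -> basis_or_unit (predU (placed n) unplaced) F ->
  (forall u, placed n u -> [:: u] \in F) ->
  costSR (@bblk m n) F [:: (bvar1 n k, true)].
Proof.
move=> le_nk lo up units; set c := (bvar1 n k, true).
have pos x y : drop_sub k x = SL y -> y.2 = true.
  by rewrite /drop_sub; case: (val x) => [[i j]|[i|_]] //; case: ifP => // _ [<-].
have subC x : collision x -> drop_sub k x = SC var false.
  by rewrite /collision /drop_sub; case: (val x) => [[]|[]].
apply: (costSR_unit (s := drop_sub k)).
- move=> v y; rewrite /drop_sub; case: (bvarP v) => [i j|i|{}v i l j -> _] //=;
    case: ifP => // ne [<-] //= [ei]; by rewrite ei eqxx in ne.
- move=> X D XcF e.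
  have refute : nontaut D -> nontaut D /\ exists2 E, E \in F &
      forall u, u \in E -> [\/ u = c, u \in D | killed F c u].
    split=> //; exists (pigeon_clause k).
      exact/lo/subset_catl/pigeon_clause_BPHP.
    move=> u /mem_pigeon_clause[[j ->]|->]; last by constructor 1.
    constructor 3; exists [:: (pvar k j, false)]; last first.
      by move=> y; rewrite inE => /eqP->; left.
    (* Every hole satisfies [j < n <= k], so [~p_{k,j}] belongs to [placed n]. *)
    by apply: units; rewrite /placed /=; have := ltn_ord j; lia.
  move: XcF; rewrite inE => /orP[/eqP eX|XF].
    apply: refute; apply: (sub_mono (b := true) pos e) => u.
    by rewrite eX inE => /eqP->.
  have keep : (forall u, u \in X -> drop_sub k u.1 = SL (u.1, true)) ->
      nontaut X -> nontaut D /\ exists2 E, E \in F &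
        forall u, u \in E -> [\/ u = c, u \in D | killed F c u].
    by move=> Hid ntX; apply: derivable_trivial XF => //; apply: restrict_id e.
  case: (up X XF) => [/basis_inv[[i eX]|[x cx eX]|[i [l [j [ne sub inX]]]]]|[u pu eX]].
  + have [ei|nei] := eqVneq i k.
      apply: refute; apply: (sub_mono (b := true) pos e) => u.
      by rewrite eX => /mem_pigeon_clause[[j ->]|->].
    apply: keep.
      move=> u; rewrite eX /drop_sub.
      by move=> /mem_pigeon_clause[[d ->]|->] /=; rewrite (negPf nei).
    rewrite eX; apply: (nontaut_mono (b := true)) => u.
    by move=> /mem_pigeon_clause[[d ->]|->].
  + case: (restrict_sat e (x := (x, false))); first by rewrite eX mem_head.
    by rewrite /lit_sub subC.
  + have iX : (pvar i j, false) \in X by apply: sub; rewrite mem_head.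
    have lX : (pvar l j, false) \in X by apply: sub; rewrite !inE eqxx orbT.
    have satX a : (pvar a j, false) \in X -> a != k.
      move=> aX; apply/eqP => ea; apply: (restrict_sat e aX).
      by rewrite /lit_sub /drop_sub /= ea eqxx.
    split.
      apply: (sub_mono (b := false) pos e) => u /inX[|cu []]; last exact: subC.
      by rewrite !inE => /orP[]/eqP->.
    exists (hole_clause i l j).
      exact/lo/subset_catr/subset_catr/hole_clauses_mem.
    move=> u; rewrite !inE => /orP[]/eqP->; constructor 2.
      apply: (mem_restrict_neg e iX).
      by rewrite /drop_sub /= (negPf (satX _ iX)).
    apply: (mem_restrict_neg e lX).
    by rewrite /drop_sub /= (negPf (satX _ lX)).
  + case: (boolP (if drop_sub k u.1 is SL _ then true else false)) => [id|nid].
      apply: keep; last by rewrite eX; apply: nontaut_unit.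
      move=> y; rewrite eX inE => /eqP->; move: id; rewrite /drop_sub.
      by case: (val u.1) => [[i j]|[i|//]]; case: ifP.
    case eu: (drop_sub k u.1) nid => [b|//] _.
    apply: refute; apply: (sub_mono (b := true) pos e) => y.
    rewrite eX inE => /eqP-> ny; case: ny; rewrite eu.
    by move: eu; rewrite /drop_sub; case: (val u.1) => [[i j]|[i|_]];
       do ?case: ifP => // _; case=> <-.
- move=> t _.
  apply: (cost_move (v := bvar1 n k) (w := bvar1 n k)) => [//|v bv nv|].
  + rewrite nv /comp_asg /drop_sub.
    case: (bvarP v) bv nv => [//|i|{}v i l j ev _] _ _ /=; last by rewrite ev.
    by case: ifP => // _; rewrite /lit_val /= eqb_id.
  + by rewrite /comp_asg /drop_sub /= eqxx.
Qed.

(** * Assembling the derivation phase by phase *)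

Lemma mem_seq2C (T : eqType) (a b : T) : [:: a; b] =i [:: b; a].
Proof. by move=> u; rewrite !inE orbC. Qed.

Lemma eq_mem_rcons (T : eqType) (s t : seq T) a : s =i t -> rcons s a =i a :: t.
Proof. by move=> st u; rewrite mem_rcons !inE st. Qed.

Lemma hole_clauseC i l j : hole_clause i l j =i hole_clause l i j.
Proof. exact: mem_seq2C. Qed.

(** Collision variables exist only for ordered pairs, so for [l < i] the axiom is that of [l] and
    [i], equal up to the order of literals. *)
Lemma conflict_clause i l j : i != l -> exists2 x, collision x &
  exists2 X, X \in BPHP m n & X =i (x, true) :: hole_clause i l j.
Proof.
have ordered (a b : 'I_m) (lt_ab : a < b) : exists2 x, collision x &
    rcons (hole_clause a b j) (x, true) \in BPHP m n.
  pose x : var := exist _ (inr (inr (a, b, j))) lt_ab.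
  by exists x => //; apply: collision_clause_BPHP.
move=> ne; case: (ltngtP i l) => [/ordered|/ordered|/val_inj eil].
- case=> x cx xF; exists x => //; eexists; first exact: xF.
  by move=> u; rewrite mem_rcons.
- case=> x cx xF; exists x => //; eexists; first exact: xF.
  exact: eq_mem_rcons (hole_clauseC l i j).
- by rewrite eil eqxx in ne.
Qed.

Lemma hole_clause_valid pi i l j :
  {subset BPHP m n <= pi} -> {subset no_collision <= pi} -> i != l ->
  valid_step (@bblk m n) (BPHP m n) pi (hole_clause i l j).
Proof.
move=> ax nc /(conflict_clause j)[x cx [X XF eX]]; right; right; left.
exists X, [:: (x, false)], x; split.
- exact: ax.
- exact/nc/no_collision_mem.
- by rewrite eX mem_head.
- exact: mem_head.
move=> u; rewrite eX (in_cons (x, true)); split.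
  move=> ul; left; rewrite ul orbT; split=> //.
  apply/eqP => eu; move: ul; rewrite eu /hole_clause !in_cons in_nil.
  by rewrite !xpair_eqE !andbF.
case=> -[+ /negbTE une]; first by rewrite une.
by rewrite in_cons une.
Qed.

Lemma derivation_basis : 0 < n -> derivation (@bblk m n) (BPHP m n) basis.
Proof.
move=> n0; rewrite /basis catA; have nil : derivation (@bblk m n) (BPHP m n) [::] by [].
have dax : derivation (@bblk m n) (BPHP m n) (BPHP m n).
  by have := @derivation_cat _ _ _ _ (BPHP m n) nil; apply=> L' _ D DF; left.
apply: derivation_cat => [|L' _ D]; last first.
  case/mapP=> -[[i l] j]; rewrite mem_filter => /andP[ne _] ->.
  apply: hole_clause_valid => // X XF; apply/subset_catl.
    exact/subset_catl.
  exact/subset_catr.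
apply: derivation_cat => // L' sub D.
case/mapP=> x; rewrite mem_filter => /andP[cx _] ->; right; right; right.
split; last by move=> y _; apply: vars_BPHP.
apply: eject_step => // X; first exact: subset_catl.
by rewrite catA !(mem_cat X) orbb => /orP[->//|/sub->]; rewrite orbT.
Qed.

Definition units (P : pred (lit var)) : cnf var :=
  [seq [:: u] | u <- enum {: lit var} & P u].

Lemma mem_units (P : pred (lit var)) u : P u -> [:: u] \in units P.
Proof. by move=> Pu; apply: map_f; rewrite mem_filter Pu mem_enum. Qed.

Lemma units_inv (P : pred (lit var)) X : X \in units P -> exists2 u, P u & X = [:: u].
Proof. by case/mapP=> u; rewrite mem_filter => /andP[Pu _] ->; exists u. Qed.

Lemma size_units (P : pred (lit var)) : size (units P) <= 2 * #|var|.
Proof.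
rewrite size_map size_filter mulnC -card_bool -card_prod cardE.
exact: count_size.
Qed.

(** One phase: all units in [P] are appended, each being cost-SR over any [F] that contains the
    earlier clauses and obeys the invariant [up]. *)
Lemma derivation_units (P Q up : pred (lit var)) pi : 0 < n ->
  derivation (@bblk m n) (BPHP m n) pi ->
  basis_or_unit Q (BPHP m n ++ pi) -> subpred Q up -> subpred P up ->
  (forall F c, {subset BPHP m n ++ pi <= F} -> basis_or_unit up F -> P c ->
     costSR (@bblk m n) F [:: c]) ->
  derivation (@bblk m n) (BPHP m n) (pi ++ units P) /\
  basis_or_unit up (BPHP m n ++ (pi ++ units P)).
Proof.
move=> n0 dpi inv QU PU step.
have up_inv L' : {subset L' <= units P} ->
    basis_or_unit up (BPHP m n ++ (pi ++ L')).
  move=> sub X; rewrite catA mem_cat => /orP[/inv[|[u /QU]]|/sub/units_inv[u /PU]].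
  - by left.
  - by right; exists u.
  - by right; exists u.
split; last exact: up_inv.
apply: derivation_cat => // L' sub D /units_inv[c Pc ->].
right; right; right; split; last by move=> x _; apply: vars_BPHP.
apply: step => //; last exact: up_inv.
by rewrite catA; apply: subset_catl.
Qed.

Definition entering (s : nat) : pred (lit var) := fun u =>
  if val u.1 is inl (i, j) then [&& ~~ u.2, s < i & j == s :> nat] else false.

(** These are [p_{s,s}], [~b_s] and [~p_{s,j}] for [j > s]; the literals [~p_{s,j}] with [j < s] are
    already in [placed s]. *)
Definition settling (s : nat) : pred (lit var) := fun u =>
  [&& placed s.+1 u, ~~ placed s u & ~~ entering s u].

(** Negating [~p_{k,s}] puts [k] into hole [s], and the hole clauses with [k] then kill [p_{i,s}]
    for every other pigeon [i]. *)
Lemma entering_step (s : 'I_m) F c : s < n ->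
  {subset basis <= F} -> basis_or_unit (placed s.+1) F ->
  (forall u, placed s u -> [:: u] \in F) -> entering s c ->
  costSR (@bblk m n) F [:: c].
Proof.
move=> lt_sn lo up un; case: c => v b; rewrite /entering /=.
case: (bvarP v) => [k j|k|{}v k l j -> _] //= /and3P[/negbTE-> lt_sk /eqP ej].
apply: (swap_step (k := k) (ltnW lt_sk) lt_sn lo up un).
- rewrite /lit_sub /swap_sub /= ej eqxx.
  by have /negbTE -> : k != s by rewrite -val_eqE /= gtn_eqF.
- move=> x y; rewrite /swap_sub; case: (bvarP x) => [i j'|i|{}x i l j' -> _] //=.
    do 2 case: ifP => //; move=> _ nj [<-] /= [_ ejj].
    by rewrite ejj ej eqxx in nj.
  by case: ifP => // _ [<-].
- move=> i j' ne ej'; exists (hole_clause i k j').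
    exact/lo/subset_catr/subset_catr/hole_clauses_mem.
  have -> : j' = j by apply: val_inj; rewrite /= ej; apply/eqP.
  by move=> u; rewrite !inE => /orP[]/eqP->; [left|right].
Qed.

(** The degenerate swap [k = s]: the literals [p_{i,s}] are killed by the units of [placed s] for
    [i < s] and of [entering s] for [i > s]. *)
Lemma settling_step (s : 'I_m) F c : s < n ->
  {subset basis <= F} -> basis_or_unit (placed s.+1) F ->
  (forall u, placed s u || entering s u -> [:: u] \in F) -> settling s c ->
  costSR (@bblk m n) F [:: c].
Proof.
move=> lt_sn lo up un Sc.
have un' u : placed s u -> [:: u] \in F by move=> pu; apply: un; rewrite pu.
apply: (swap_step (leqnn s) lt_sn lo up un').
- case: c Sc => v b; rewrite /settling /placed /entering /lit_sub /swap_sub /=.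
  case: (bvarP v) => [i j|i|{}v i l j -> _] //=.
    rewrite -!val_eqE /=; case: (eqVneq (j : nat) s) => ej;
    case: (eqVneq (i : nat) s) => ei; case: b => //= S; exfalso; lia.
  by rewrite -val_eqE /=; case: (eqVneq (i : nat) s) => ei; case: b => //= S;
    exfalso; lia.
- move=> x y; case: c Sc => v b; rewrite /settling /placed /entering /swap_sub /=.
  rewrite /swap_pigeon.
  case: (bvarP x) => [i' j'|i'|{}x i' l' j' -> _] //=;
    case: (bvarP v) => [i j|i|{}v i l j -> _] //=.
  + move=> S; do 2 case: ifP => //; move=> ni nj [<-] /=; rewrite ni => -[ei ej].
    rewrite ei ej in ni nj; move: S ni nj.
    by rewrite -!val_eqE /=; case: b; lia.
  + by move=> _; do 2 case: ifP => //; move=> _ _ [<-].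
  + by move=> _; case: ifP => // _ [<-].
  + move=> S; case: ifP => // ni [<-] /=; rewrite ni => -[ei].
    by rewrite ei in ni; move: S ni; rewrite -!val_eqE /=; case: b; lia.
- move=> i j; rewrite -val_eqE /= => ni ej; exists [:: (pvar i j, false)].
    by apply: un; rewrite /placed /entering /=; lia.
  by move=> u; rewrite inE => /eqP->; left.
Qed.

Lemma placed_derivation s : 0 < n -> n < m -> s <= n -> exists pi,
  [/\ derivation (@bblk m n) (BPHP m n) (basis ++ pi),
      basis_or_unit (placed s) (BPHP m n ++ (basis ++ pi)),
      (forall u, placed s u -> [:: u] \in basis ++ pi) &
      size pi <= s * (4 * #|var|)].
Proof.
move=> n0 lt_nm; elim: s => [_|s IH lt_sn].
  exists [::]; rewrite cats0; split=> //; first exact: derivation_basis.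
  - by move=> X; rewrite mem_cat => /orP[XB|]; left=> //; apply: subset_catl.
  - case=> v b; rewrite /placed /=.
    by case: (bvarP v) => [i j|i|{}v i l j -> _] //=; case: b; rewrite ?andbF.
have [pi [dpi inv un szpi]] := IH (ltnW lt_sn).
pose sm : 'I_m := Ordinal (ltn_trans lt_sn lt_nm).
have placedS : subpred (placed s) (placed s.+1).
  case=> v b; rewrite /placed /=.
  by case: (bvarP v) => [i j|i|{}v i l j -> _] //=; case: b; lia.
have enteringS : subpred (entering s) (placed s.+1).
  case=> v b; rewrite /placed /entering /=.
  by case: (bvarP v) => [i j|i|{}v i l j -> _] //=; case: b; lia.
have basisF F pi' : {subset BPHP m n ++ (basis ++ pi') <= F} -> {subset basis <= F}.
  by move=> sub X XB; apply/sub/subset_catr/subset_catl.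
have [dpiA invA] :
    derivation (@bblk m n) (BPHP m n) ((basis ++ pi) ++ units (entering s)) /\
    basis_or_unit (placed s.+1)
      (BPHP m n ++ ((basis ++ pi) ++ units (entering s))).
  apply: derivation_units inv placedS enteringS _ => // F c sub up.
  apply: (entering_step (s := sm)) => //; first exact: basisF sub.
  by move=> u /un uF; apply/sub/subset_catr.
have [dpiB invB] :
    derivation (@bblk m n) (BPHP m n)
      (((basis ++ pi) ++ units (entering s)) ++ units (settling s)) /\
    basis_or_unit (placed s.+1)
      (BPHP m n ++ (((basis ++ pi) ++ units (entering s)) ++ units (settling s))).
  apply: derivation_units invA _ _ _ => // [u /and3P[]//|F c sub up].
  apply: (settling_step (s := sm)) => //.
    by move: sub; rewrite -catA; apply: basisF.
  move=> u /orP[/un uF|/mem_units uF]; apply/sub/subset_catr.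
    exact: subset_catl.
  exact: subset_catr.
exists (pi ++ units (entering s) ++ units (settling s)).
rewrite !catA; split=> //; first by rewrite -!catA in invB *.
  move=> u pu; have [/un uF|npu] := boolP (placed s u).
    exact/subset_catl/subset_catl.
  have [eu|neu] := boolP (entering s u).
    exact/subset_catl/subset_catr/mem_units.
  by apply/subset_catr/mem_units/and3P.
(* Each round adds two phases of at most [2 * #|var|] units, hence the factor 4. *)
rewrite !size_cat; have := size_units (entering s); have := size_units (settling s).
by lia.
Qed.

(** * Size bounds and the final proof *)

Lemma card_var : #|var| <= m * n + (m + m * m * n).
Proof.
have := leq_card (val : var -> bphp_raw m n) val_inj.
by rewrite !card_sum !card_prod !card_ord.
Qed.

Lemma size_basis : size basis <= m + m * m * n + (#|var| + m * m * n).
Proof.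
rewrite /basis /no_collision /hole_clauses /BPHP !size_cat -!addnA.
apply: leq_add; last (apply: leq_add; last apply: leq_add).
- by rewrite size_map size_enum_ord.
- rewrite size_pmap; apply: leq_trans (count_size _ _) _.
  by rewrite !size_allpairs !size_enum_ord.
- by rewrite size_map size_filter cardE; apply: count_size.
- rewrite size_map size_filter; apply: leq_trans (count_size _ _) _.
  by rewrite -cardE !card_prod !card_ord.
Qed.

Lemma BPHP_cost_proof : 0 < n -> n < m -> exists pi,
  cost_proof (@bblk m n) (BPHP m n) (m - n) pi /\
  size pi <= 24 * (m + n) ^ 4.
Proof.
move=> n0 lt_nm.
have [pi [dpi inv un szpi]] := placed_derivation n0 lt_nm (leqnn n).
have [dpiF _] :
    derivation (@bblk m n) (BPHP m n) ((basis ++ pi) ++ units unplaced) /\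
    basis_or_unit (predU (placed n) unplaced)
      (BPHP m n ++ ((basis ++ pi) ++ units unplaced)).
  apply: derivation_units inv _ _ _ => // [u pu|u uu|F c sub up].
  - by rewrite /= pu.
  - by rewrite /= uu orbT.
  case: c => v b; rewrite /unplaced /=.
  case: (bvarP v) => [k j|k|{}v k l j -> _] //= /andP[-> le_nk].
  apply: unplaced_step => //.
    by move=> X XB; apply/sub/subset_catr/subset_catl.
  by move=> u /un uF; apply/sub/subset_catr.
exists ((basis ++ pi) ++ units unplaced); split; last first.
  rewrite size_cat [size (basis ++ pi)]size_cat.
  have := size_units unplaced; have := size_basis; have := card_var.
  (* There are at most [3 * N ^ 3] variables, so the basis contributes [6 * N ^ 3], the placements
     [12 * N ^ 4] and the last units [6 * N ^ 3], in total at most [24 * N ^ 4]. *)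
  set N := m + n; set v := #|var| in szpi *; rewrite (expnS N 3) => hv hb hu.
  have [leM leN] : m <= N /\ n <= N by rewrite leq_addr leq_addl.
  have N0 : 0 < N by apply: leq_trans leN.
  have mmn3 : m * m * n <= N ^ 3 by rewrite !expnS muln1 mulnA !leq_mul.
  have mn3 : m * n <= N ^ 3.
    by apply: leq_trans (leq_pexp2l N0 (isT : 2 <= 3)); rewrite leq_mul.
  have m3 : m <= N ^ 3 by apply: leq_trans (leq_pexp2l N0 (isT : 1 <= 3)).
  have nv : n * v <= N * (3 * N ^ 3) by apply: leq_mul => //; lia.
  have N34 : N ^ 3 <= N * N ^ 3 by rewrite leq_pmull.
  by move: nv N34 mmn3 mn3 m3; move: (N ^ 3) => P; lia.
split=> //.
(* The cost is charged to the pigeons [k >= n]. The other blocking variables are refuted by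
   [placed n] for [i < n] and by [no_collision]. *)
exists [set bvar1 n k | k in [set k : 'I_m | n <= k]]; split.
- rewrite card_imset; last by move=> k l [].
  rewrite -sum1_card -[RHS]muln1 -sum_nat_const_nat big_geq_mkord.
  by apply: eq_bigl => k; rewrite inE.
- by move=> x /imsetP[k _ ->].
- move=> x /imsetP[k]; rewrite inE => le_nk ->.
  exact/subset_catr/mem_units.
- move=> x; case: (bvarP x) => [//|k|{}x i l j ex _] _ nS.
    apply/subset_catl/un; rewrite /placed /= ltnNge; apply: contra nS => le_nk.
    by apply: imset_f; rewrite inE.
  apply/subset_catl/subset_catl/subset_catr/subset_catl/no_collision_mem.
  by rewrite /collision ex.
Qed.

End Pigeonhole.

Theorem theorem6p3 :
  exists c d : nat, forall m n : nat, 1 <= n -> n < m ->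
    exists pi : seq (clause (bvar m n)),
      cost_proof (@bblk m n) (BPHP m n) (m - n) pi /\
      size pi <= c * (m + n) ^ d.
Proof. by exists 24, 4 => m n; apply: BPHP_cost_proof. Qed.
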